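(* Let $A$ be a commutative Noetherian ring, and fix $r\ge 1$. For any $J\in\mathbb{Z}_{\ge 0}^r$, the FI-module $(R^{(r)}_J)^\vee$ over $A$ is finitely generated.
   Context: Let $\mathrm{FI}$ be the category whose objects are finite sets and whose morphisms are injections; $[n]=\{1,\dots,n\}$, $[0]=\emptyset$. An FI-module over $A$ is a covariant functor $V$ from $\mathrm{FI}$ to $A$-modules; write $V_S=V(S)$, $V_n=V([n])$, $f_*=V(f)$. A sub-FI-module $W\subset V$ is a collection of submodules $W_S\subset V_S$ with $f_*(W_S)\subset W_T$ for every injection $f\colon S\to T$. $V$ is finitely generated if some finite subset of $\coprod_{n\ge 0}V_n$ is contained in no proper sub-FI-module of $V$. For a finite set $T$, let $A[\mathbf{X}^{(r)}(T)]$ be the polynomial $A$-algebra on generators $x_{(i,t)}$ indexed by $(i,t)\in[r]\times T$, with the $\mathbb{Z}_{\ge 0}^r$-grading whose $i$th component is the total degree in the generators $x_{(i,t)}$, $t\in T$. An injection $f\colon S\hookrightarrow T$ induces a ring homomorphism $f^*\colon A[\mathbf{X}^{(r)}(T)]\to A[\mathbf{X}^{(r)}(S)]$ with $f^*(x_{(i,t)})=x_{(i,s)}$ if $f(s)=t$ and $f^*(x_{(i,t)})=0$ if $t\notin\operatorname{im}f$. In particular the group $S_T$ of permutations of $T$ acts on $A[\mathbf{X}^{(r)}(T)]$. Let $I_T$ be the ideal generated by the $S_T$-invariant polynomials with zero constant term, and let $R^{(r)}(T)=A[\mathbf{X}^{(r)}(T)]/I_T$, which inherits the $\mathbb{Z}_{\ge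 0}^r$-grading; $R^{(r)}_J(T)$ is its graded piece of multidegree $J$. One has $f^*(I_T)\subset I_S$, so $T\mapsto R^{(r)}_J(T)$ is a contravariant functor from $\mathrm{FI}$ to $A$-modules. The FI-module $(R^{(r)}_J)^\vee$ is defined by $(R^{(r)}_J)^\vee(T)=\operatorname{Hom}_A(R^{(r)}_J(T),A)$. *)

(* Defs.v *)
From HB Require Import structures.
From mathcomp Require Import all_boot perm all_algebra.
From mathcomp Require Import generic_quotient ring_quotient boolp classical_sets.
From mathcomp Require Import mpoly.

Set Implicit Arguments.
Unset Strict Implicit.
Unset Printing Implicit Defensive.

Import GRing.Theory.

Local Open Scope ring_scope.
Local Open Scope quotient_scope.

Definition is_ideal (R : comNzRingType) (I : set R) : Prop :=
  I 0 /\ forall a x y : R, I x -> I y -> I (a * x + y).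

Definition ideal_gen (R : comNzRingType) (G : set R) : set R := fun x =>
  exists s : seq (R * R),
    (forall u, u \in s -> G u.2) /\ x = \sum_(u <- s) u.1 * u.2.

Definition noetherian (R : comNzRingType) : Prop :=
  forall I : set R, is_ideal I ->
    exists s : seq R, I = ideal_gen (fun x => x \in s).

Section IdealGen.
Variables (R : comNzRingType) (G : set R).

Lemma ideal_gen_is_ideal : is_ideal (ideal_gen G).
Proof.
split; first by exists [::]; split => //; rewrite big_nil.
move=> a x y [s [sG ->]] [t [tG ->]].
exists ([seq (a * u.1, u.2) | u <- s] ++ t); split.
  by move=> u; rewrite mem_cat => /orP[/mapP[v vs ->]|/tG]; first exact: (sG v).
rewrite big_cat big_map mulr_sumr; congr (_ + _).
by apply: eq_bigr => u _; rewrite mulrA.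
Qed.

End IdealGen.

Record FIhom (S T : finType) := FIHom {
  FIfun :> S -> T;
  FIinj : injective FIfun }.

Definition FIid (S : finType) : FIhom S S := FIHom (@inj_id S).

Definition FIcomp (S T U : finType) (g : FIhom T U) (f : FIhom S T) :
  FIhom S U := FIHom (inj_comp (@FIinj _ _ g) (@FIinj _ _ f)).

Definition FIperm (S : finType) (s : {perm S}) : FIhom S S :=
  FIHom (@perm_inj S s).

Record FImodule (A : comNzRingType) := FIModule {
  FIobj :> finType -> lmodType A;
  FImap : forall S T : finType, FIhom S T -> {linear FIobj S -> FIobj T};
  FImap_id : forall (S : finType) (v : FIobj S), FImap (FIid S) v = v;
  FImap_comp : forall (S T U : finType) (g : FIhom T U) (f : FIhom S T)
    (v : FIobj S), FImap (FIcomp g f) v = FImap g (FImap f v) }.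

Record subFImodule (A : comNzRingType) (V : FImodule A) := SubFIModule {
  subFI :> forall S : finType, set (V S);
  subFI0 : forall S : finType, @subFI S 0;
  subFIlin : forall (S : finType) (a : A) (v w : V S),
    @subFI S v -> @subFI S w -> @subFI S (a *: v + w);
  subFImap : forall (S T : finType) (f : FIhom S T) (v : V S),
    @subFI S v -> @subFI T (FImap V f v) }.

Definition proper_subFI (A : comNzRingType) (V : FImodule A)
    (W : subFImodule V) : Prop :=
  exists S : finType, W S <> [set: V S]%classic.

(* The disjoint union of the V_n is the sigma type below, with 'I_n for [n]. *)
Definition FI_finitely_generated (A : comNzRingType) (V : FImodule A) : Prop :=
  exists s : seq {n : nat & V 'I_n},
    forall W : subFImodule V,
      (forall x : {n : nat & V 'I_n}, x \in s -> W 'I_(tag x) (tagged x)) ->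
      ~ proper_subFI W.

Definition dual (A : comNzRingType) (V : lmodType A) := {linear V -> A^o}.

Section Dual.
Variables (A : comNzRingType) (V : lmodType A).
Implicit Types (phi psi chi : dual V) (a b : A).

HB.instance Definition _ := gen_eqMixin (dual V).
HB.instance Definition _ := gen_choiceMixin (dual V).

Lemma dualP phi psi : (forall v, phi v = psi v) -> phi = psi.
Proof.
move: phi psi => [f [[mf] [sf]]] [g [[mg] [sg]]] /= fg.
have {}fg : f = g by apply/funext.
subst g; congr GRing.Linear.Pack; congr GRing.Linear.Class.
  by rewrite (Prop_irrelevance mf mg).
by rewrite (Prop_irrelevance sf sg).
Qed.

Definition dual0 : dual V := (\0 : {linear V -> A^o})%R.
Definition dual_opp phi : dual V := \- phi.
Definition dual_add phi psi : dual V := phi \+ psi.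
Definition dual_scale a phi : dual V := a \*: phi.

Lemma dual_addA : associative dual_add.
Proof. by move=> f g h; apply: dualP => v; exact: addrA. Qed.
Lemma dual_addC : commutative dual_add.
Proof. by move=> f g; apply: dualP => v; exact: addrC. Qed.
Lemma dual_add0 : left_id dual0 dual_add.
Proof. by move=> f; apply: dualP => v; exact: add0r. Qed.
Lemma dual_addN : left_inverse dual0 dual_opp dual_add.
Proof. by move=> f; apply: dualP => v; exact: addNr. Qed.

HB.instance Definition _ := GRing.isZmodule.Build (dual V)
  dual_addA dual_addC dual_add0 dual_addN.

Lemma dual_scaleA a b phi : dual_scale a (dual_scale b phi) = dual_scale (a * b) phi.
Proof. by apply: dualP => v; exact: scalerA. Qed.
Lemma dual_scale1 : left_id 1 dual_scale.
Proof. by move=> f; apply: dualP => v; exact: scale1r. Qed.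
Lemma dual_scaleDr : right_distributive dual_scale +%R.
Proof. by move=> a f g; apply: dualP => v; exact: scalerDr. Qed.
Lemma dual_scaleDl phi : {morph dual_scale^~ phi : a b / a + b}.
Proof. by move=> a b; apply: dualP => v; exact: scalerDl. Qed.

HB.instance Definition _ := GRing.Zmodule_isLmodule.Build A (dual V)
  dual_scaleA dual_scale1 dual_scaleDr dual_scaleDl.

End Dual.

Section DualMap.
Variables (A : comNzRingType) (U V : lmodType A) (h : {linear U -> V}).

Definition dual_map (phi : dual V) : dual U := phi \o h.

Lemma dual_map_is_linear : linear dual_map.
Proof. by move=> a f g; apply: dualP. Qed.

HB.instance Definition _ :=
  GRing.isLinear.Build A (dual V) (dual U) *:%R dual_map dual_map_is_linear.

End DualMap.

(* The library indexes variables by ordinals: x_(i,t) is the variable of rank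
   enum_rank (i, t). *)
Definition FIpoly (A : comNzRingType) (r : nat) (T : finType) :=
  {mpoly A[#|{: 'I_r * T}|]}.

HB.instance Definition _ (A : comNzRingType) r T :=
  GRing.ComNzRing.on (FIpoly A r T).
HB.instance Definition _ (A : comNzRingType) r T :=
  GRing.Lmodule.on (FIpoly A r T).

Definition FIvar (A : comNzRingType) (r : nat) (T : finType) (i : 'I_r) (t : T) :
  FIpoly A r T := 'X_(enum_rank (i, t)).

Definition pull_var (A : comNzRingType) (r : nat) (S T : finType)
    (f : FIhom S T) (i : 'I_r) (t : T) : FIpoly A r S :=
  if [pick s | f s == t] is Some s then FIvar A i s else 0.

Definition pull (A : comNzRingType) (r : nat) (S T : finType) (f : FIhom S T)
    (p : FIpoly A r T) : FIpoly A r S :=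
  mmap (@mpolyC #|{: 'I_r * S}| A)
    (fun k => pull_var A f (enum_val k).1 (enum_val k).2) p.

(* pull along s is the action of s^-1, which has the same invariants. *)
Definition FIinvariant (A : comNzRingType) (r : nat) (T : finType)
    (p : FIpoly A r T) : Prop :=
  forall s : {perm T}, pull (FIperm s) p = p.

Definition coinv_ideal (A : comNzRingType) (r : nat) (T : finType) :
    FIpoly A r T -> bool :=
  fun p => `[< ideal_gen
    (fun g : FIpoly A r T => FIinvariant g /\ g@_0%MM = 0) p >].

Section Pull.
Variables (A : comNzRingType) (r : nat).

Section OneMap.
Variables (S T : finType) (f : FIhom S T).

HB.instance Definition _ :=
  GRing.RMorphism.copy (@pull A r S T f)
    (mmap (@mpolyC #|{: 'I_r * S}| A)
      (fun k => pull_var A f (enum_val k).1 (enum_val k).2)).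

Lemma pull_scalable : scalable (@pull A r S T f).
Proof. by move=> a p; rewrite /pull mmapZ mul_mpolyC. Qed.

HB.instance Definition _ :=
  GRing.isScalable.Build A (FIpoly A r T) (FIpoly A r S) *:%R (@pull A r S T f)
    pull_scalable.

Lemma pullC (a : A) : pull f (a%:MP : FIpoly A r T) = a%:MP.
Proof. exact: mmapC. Qed.

Lemma pull_FIvar (i : 'I_r) (t : T) : pull f (FIvar A i t) = pull_var A f i t.
Proof. by rewrite /pull /FIvar mmapX mmap1U enum_rankK. Qed.

Lemma pull_FIvar_im (i : 'I_r) (s : S) : pull f (FIvar A i (f s)) = FIvar A i s.
Proof.
rewrite pull_FIvar /pull_var; case: pickP => [s' /eqP/FIinj -> //|/(_ s)].
by rewrite eqxx.
Qed.

Lemma pull_FIvar_notin (i : 'I_r) (t : T) :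
  (forall s, f s <> t) -> pull f (FIvar A i t) = 0.
Proof.
by move=> nft; rewrite pull_FIvar /pull_var; case: pickP => [s /eqP/nft|].
Qed.

End OneMap.

Lemma FIpoly_rmorph_ext (T : finType) (Q : comNzRingType)
    (g h : {rmorphism FIpoly A r T -> Q}) :
  (forall a : A, g a%:MP = h a%:MP) ->
  (forall i t, g (FIvar A i t) = h (FIvar A i t)) -> g =1 h.
Proof.
move=> gC gX p; rewrite (mpolyE p) !rmorph_sum; apply: eq_bigr => m _.
rewrite -mul_mpolyC (mpolyXE_id _ m).
rewrite (rmorphM g) (rmorphM h) gC (rmorph_prod g) (rmorph_prod h).
congr (_ * _); apply: eq_bigr => k _; rewrite (rmorphXn g) (rmorphXn h).
congr (_ ^+ _); have := gX (enum_val k).1 (enum_val k).2.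
by rewrite /FIvar -surjective_pairing enum_valK.
Qed.

Lemma pull_id (T : finType) (p : FIpoly A r T) : pull (FIid T) p = p.
Proof.
apply: (@FIpoly_rmorph_ext _ _ (pull (FIid T)) idfun) => [a|i t].
  exact: pullC.
exact: (pull_FIvar_im (FIid T)).
Qed.

Lemma pull_comp (S T U : finType) (g : FIhom T U) (f : FIhom S T)
  (p : FIpoly A r U) : pull (FIcomp g f) p = pull f (pull g p).
Proof.
apply: (@FIpoly_rmorph_ext _ _ (pull (FIcomp g f)) (pull f \o pull g)).
  by move=> a; rewrite /= !pullC.
move=> i u /=; case: (pickP (fun t => g t == u)) => [t /eqP <-|nu].
  rewrite pull_FIvar_im.
  case: (pickP (fun s => f s == t)) => [s /eqP <-|nt].
    by rewrite (pull_FIvar_im (FIcomp g f)) pull_FIvar_im.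
  rewrite !pull_FIvar_notin // => s; first by move/eqP; rewrite nt.
  by move/(@FIinj _ _ g)/eqP; rewrite nt.
rewrite [X in pull f X]pull_FIvar_notin ?raddf0 => [|t /eqP]; last by rewrite nu.
by rewrite pull_FIvar_notin // => s /eqP; rewrite nu.
Qed.

Lemma pull_eq (S T : finType) (f g : FIhom S T) (p : FIpoly A r T) :
  f =1 g -> pull f p = pull g p.
Proof.
move=> fg; congr (pull _ p); case: f fg => f fi; case: g => g gi /= /funext fg.
by subst g; congr FIHom; exact: Prop_irrelevance.
Qed.

Lemma pull_const (S T : finType) (f : FIhom S T) (p : FIpoly A r T) :
  (pull f p)@_0%MM = p@_0%MM.
Proof.
apply: (@FIpoly_rmorph_ext _ _ (mcoeff 0%MM \o pull f) (mcoeff 0%MM)) => /=.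
  by move=> a; rewrite /= pullC !mcoeffC !eqxx.
move=> i t; rewrite /= pull_FIvar /pull_var /FIvar.
by case: pickP => [s _|_]; rewrite ?mcoeff0 !mcoeffX ?mnm1_eq0.
Qed.

Lemma perm_extend (S T : finType) (f : FIhom S T) (s : {perm S}) :
  exists t : {perm T}, forall x, t (f x) = f (s x).
Proof.
pose h t := if [pick x | f x == t] is Some x then f (s x) else t.
have hf x : h (f x) = f (s x).
  rewrite /h; case: pickP => [x' /eqP/FIinj -> //|/(_ x)].
  by rewrite eqxx.
have hn t : (forall x, f x <> t) -> h t = t.
  by move=> nt; rewrite /h; case: pickP => [x /eqP/nt|].
have h_inj : injective h.
  move=> t u.
  case: (pickP (fun x => f x == t)) => [x /eqP <-|nt];
  case: (pickP (fun x => f x == u)) => [y /eqP <-|nu].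
  - by rewrite !hf => /FIinj/perm_inj ->.
  - rewrite hf hn => [fu|y /eqP]; last by rewrite nu.
    by have := nu (s x); rewrite fu eqxx.
  - rewrite hf hn => [fu|x /eqP]; last by rewrite nt.
    by have := nt (s y); rewrite fu eqxx.
  - by rewrite !hn // => x /eqP; rewrite ?nt ?nu.
by exists (perm h_inj) => x; rewrite permE hf.
Qed.

Lemma pull_invariant (S T : finType) (f : FIhom S T) (p : FIpoly A r T) :
  FIinvariant p -> FIinvariant (pull f p).
Proof.
move=> inv_p s; have [t tf] := perm_extend f s.
rewrite -pull_comp -[in RHS](inv_p t) -pull_comp.
by apply: pull_eq => x /=; rewrite tf.
Qed.

Lemma coinv_ideal_closed (T : finType) : idealr_closed (@coinv_ideal A r T).
Proof.
have [I0 IL] := ideal_gen_is_ideal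
  (fun g : FIpoly A r T => FIinvariant g /\ g@_0%MM = 0).
split; first exact/asboolP.
  apply/asboolP => -[s [sG /(congr1 (mcoeff 0%MM))]].
  rewrite mcoeff1 eqxx raddf_sum /= big_seq big1 => [/eqP|u us].
    by rewrite oner_eq0.
  by rewrite (rmorphM (mcoeff 0%MM)) /= (sG _ us).2 mulr0.
by move=> a p q /asboolP Ip /asboolP Iq; apply/asboolP; exact: IL.
Qed.

HB.instance Definition _ (T : finType) :=
  isIdealr.Build (FIpoly A r T) (@coinv_ideal A r T) (coinv_ideal_closed T).

Lemma pull_coinv_ideal (S T : finType) (f : FIhom S T) (p : FIpoly A r T) :
  p \in @coinv_ideal A r T -> pull f p \in @coinv_ideal A r S.
Proof.
move=> /asboolP[s [sG ->]]; apply/asboolP.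
exists [seq (pull f u.1, pull f u.2) | u <- s]; split.
  move=> _ /mapP[u us ->] /=; have [iu cu] := sG _ us.
  by split; [exact: pull_invariant | rewrite pull_const].
rewrite rmorph_sum big_map; apply: eq_bigr => u _.
exact: rmorphM.
Qed.

End Pull.

(* R^(r)(T); A acts on it through the structure map (coinv_scale below). *)
Definition coinv_alg (A : comNzRingType) (r : nat) (T : finType) :=
  {ideal_quot (@coinv_ideal A r T : idealr (FIpoly A r T))}.

HB.instance Definition _ (A : comNzRingType) r T :=
  NzRingQuotient.on (coinv_alg A r T).
HB.instance Definition _ (A : comNzRingType) r T :=
  GRing.ComNzRing.on (coinv_alg A r T).

Definition coinv_pi (A : comNzRingType) (r : nat) (T : finType)
  (p : FIpoly A r T) : coinv_alg A r T := \pi_(coinv_alg A r T) p.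

Section CoinvAlg.
Variables (A : comNzRingType) (r : nat) (T : finType).
Implicit Types (a b : A) (p q : FIpoly A r T) (x y : coinv_alg A r T).

HB.instance Definition _ := GRing.RMorphism.copy (@coinv_pi A r T)
  (\pi_(coinv_alg A r T)).

Lemma coinv_pi_surj x : exists p, x = coinv_pi p.
Proof. by exists (repr x); rewrite /coinv_pi reprK. Qed.

Lemma coinv_pi_eq p q : coinv_pi p = coinv_pi q <-> p - q \in @coinv_ideal A r T.
Proof. by rewrite Quotient.idealrBE; split => /eqP. Qed.

Definition coinv_scale a x : coinv_alg A r T := coinv_pi a%:MP * x.

Lemma coinv_scaleA a b x : coinv_scale a (coinv_scale b x) = coinv_scale (a * b) x.
Proof. by rewrite /coinv_scale mulrA -rmorphM -mpolyCM. Qed.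
Lemma coinv_scale1 : left_id 1 coinv_scale.
Proof. by move=> x; rewrite /coinv_scale rmorph1 mul1r. Qed.
Lemma coinv_scaleDr : right_distributive coinv_scale +%R.
Proof. by move=> a x y; rewrite /coinv_scale mulrDr. Qed.
Lemma coinv_scaleDl x : {morph coinv_scale^~ x : a b / a + b}.
Proof. by move=> a b; rewrite /coinv_scale mpolyCD rmorphD mulrDl. Qed.

HB.instance Definition _ := GRing.Zmodule_isLmodule.Build A (coinv_alg A r T)
  coinv_scaleA coinv_scale1 coinv_scaleDr coinv_scaleDl.

Lemma coinv_pi_scalable : scalable (@coinv_pi A r T).
Proof. by move=> a p; rewrite -mul_mpolyC rmorphM. Qed.

HB.instance Definition _ :=
  GRing.isScalable.Build A (FIpoly A r T) (coinv_alg A r T) *:%R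
    (@coinv_pi A r T) coinv_pi_scalable.

End CoinvAlg.

Definition multihomog (A : comNzRingType) (r : nat) (T : finType)
    (J : 'I_r -> nat) (p : FIpoly A r T) : Prop :=
  forall m, m \in msupp p ->
    forall i : 'I_r, (\sum_(t : T) m (enum_rank (i, t)))%N = J i.

Section Multihomog.
Variables (A : comNzRingType) (r : nat) (T : finType).
Implicit Types (J K : 'I_r -> nat) (p q : FIpoly A r T).

Lemma multihomog0 J : multihomog J (0 : FIpoly A r T).
Proof. by move=> m; rewrite msupp0. Qed.

Lemma multihomogD J p q :
  multihomog J p -> multihomog J q -> multihomog J (p + q).
Proof.
move=> hp hq m /msuppD_le; rewrite mem_cat => /orP[]; [exact: hp|exact: hq].
Qed.

Lemma multihomogZ J a p : multihomog J p -> multihomog J (a *: p).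
Proof. by move=> hp m /msuppZ_le; exact: hp. Qed.

Lemma multihomog1 : multihomog (fun=> 0%N) (1 : FIpoly A r T).
Proof.
move=> m; rewrite msupp1 inE => /eqP -> i.
by apply: big1 => t _; rewrite mnm0E.
Qed.

Lemma multihomogM J K p q : multihomog J p -> multihomog K q ->
  multihomog (fun i => J i + K i)%N (p * q).
Proof.
move=> hp hq m /msuppM_le/allpairsP[[m1 m2] /= [m1p m2q ->]] i.
rewrite -(hp _ m1p i) -(hq _ m2q i) -big_split.
by apply: eq_bigr => t _; rewrite mnmDE.
Qed.

Lemma multihomogXn J p n :
  multihomog J p -> multihomog (fun i => n * J i)%N (p ^+ n).
Proof.
move=> hp; elim: n => [|n IHn]; first exact: multihomog1.
by move=> m; rewrite exprS => /(multihomogM hp IHn) h i; rewrite h mulSn.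
Qed.

Lemma multihomog_prod (I : Type) (s : seq I) (J : I -> 'I_r -> nat)
    (F : I -> FIpoly A r T) :
  (forall k, multihomog (J k) (F k)) ->
  multihomog (fun i => \sum_(k <- s) J k i)%N (\prod_(k <- s) F k).
Proof.
move=> hF; elim: s => [|k s IHs] m.
  by rewrite big_nil => /multihomog1 h i; rewrite big_nil h.
by rewrite big_cons => /(multihomogM (hF k) IHs) h i; rewrite big_cons h.
Qed.

Lemma multihomog_FIvar (i : 'I_r) (t : T) :
  multihomog (fun j => (i == j) : nat) (FIvar A i t).
Proof.
move=> m; rewrite msuppX inE => /eqP -> j.
rewrite (bigD1 t) //= mnm1E (inj_eq enum_rank_inj) xpair_eqE eqxx andbT.
rewrite big1 ?addn0 // => t' /negPf nt.
by rewrite mnm1E (inj_eq enum_rank_inj) xpair_eqE [t == t']eq_sym nt andbF.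
Qed.

End Multihomog.

Lemma pull_multihomog (A : comNzRingType) (r : nat) (J : 'I_r -> nat)
    (S T : finType) (f : FIhom S T) (p : FIpoly A r T) :
  multihomog J p -> multihomog J (pull f p).
Proof.
move=> hp; rewrite /pull /mmap big_seq.
apply: (big_ind (fun q : FIpoly A r S => multihomog J q)).
- exact: multihomog0.
- exact: multihomogD.
move=> m mp; rewrite mul_mpolyC; apply: multihomogZ.
pose W (k : 'I_#|{: 'I_r * T}|) i := (m k * ((enum_val k).1 == i))%N.
have hW : multihomog (fun i => \sum_k W k i)%N
  (mmap1 (fun k => pull_var A f (enum_val k).1 (enum_val k).2) m
     : FIpoly A r S).
  apply: multihomog_prod => k; apply: multihomogXn.
  rewrite /pull_var; case: pickP => [s _|_]; first exact: multihomog_FIvar.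
  exact: multihomog0.
move=> m' /hW h i; rewrite h -(hp m mp i) /W.
rewrite (reindex (@enum_rank ('I_r * T)%type)) /=; last first.
  by apply: onW_bij; exact: enum_rank_bij.
under eq_bigr do rewrite enum_rankK.
transitivity (\sum_(j < r) \sum_(t : T) m (enum_rank (j, t)) * (j == i))%N.
  by rewrite pair_bigA; apply: eq_bigr => -[j t].
rewrite (bigD1 i) //= [X in (_ + X)%N]big1 ?addn0 => [|j /negPf nj].
  by apply: eq_bigr => t _; rewrite eqxx muln1.
by apply: big1 => t _; rewrite nj muln0.
Qed.

(* The multigrading of the quotient: its piece of multidegree J is the image of
   the polynomials of multidegree J. *)
Definition in_coinv_piece (A : comNzRingType) (r : nat) (J : 'I_r -> nat)
    (T : finType) : coinv_alg A r T -> bool :=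
  fun x => `[< exists2 p, multihomog J p & x = coinv_pi p >].

Section Piece.
Variables (A : comNzRingType) (r : nat) (J : 'I_r -> nat) (T : finType).

Lemma in_coinv_piece_closed : submod_closed (@in_coinv_piece A r J T).
Proof.
split.
  by apply/asboolP; exists 0; [move=> m; rewrite msupp0 | rewrite raddf0].
move=> a _ _ /asboolP[p hp ->] /asboolP[q hq ->]; apply/asboolP.
exists (a *: p + q); last by rewrite linearP.
move=> m /msuppD_le; rewrite mem_cat => /orP[/msuppZ_le|]; first exact: hp.
exact: hq.
Qed.

HB.instance Definition _ :=
  GRing.isSubmodClosed.Build A (coinv_alg A r T) (@in_coinv_piece A r J T)
    in_coinv_piece_closed.

Record coinv_piece := CoinvPiece {
  piece_val :> coinv_alg A r T;
  piece_valP : piece_val \in @in_coinv_piece A r J T }.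

HB.instance Definition _ := [isSub for piece_val].
HB.instance Definition _ := [Choice of coinv_piece by <:].
HB.instance Definition _ := [SubChoice_isSubLmodule of coinv_piece by <:].

End Piece.

Section PieceMap.
Variables (A : comNzRingType) (r : nat) (J : 'I_r -> nat).

Section OneMap.
Variables (S T : finType) (f : FIhom S T).

(* Induced by f^*; independent of the representative by coinv_mapE. *)
Definition coinv_map (x : coinv_alg A r T) : coinv_alg A r S :=
  coinv_pi (pull f (generic_quotient.repr x)).

Lemma coinv_mapE (p : FIpoly A r T) :
  coinv_map (coinv_pi p) = coinv_pi (pull f p).
Proof.
apply/coinv_pi_eq; rewrite -rmorphB; apply: pull_coinv_ideal.
by apply/coinv_pi_eq; rewrite /coinv_pi reprK.
Qed.

Lemma coinv_map_is_linear : linear coinv_map.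
Proof.
move=> a x y; have [p ->] := coinv_pi_surj x; have [q ->] := coinv_pi_surj y.
by rewrite -linearP !coinv_mapE -linearP -linearP.
Qed.

HB.instance Definition _ := GRing.isLinear.Build A (coinv_alg A r T)
  (coinv_alg A r S) *:%R coinv_map coinv_map_is_linear.

Lemma coinv_map_piece (x : coinv_piece A J T) :
  coinv_map x \in @in_coinv_piece A r J S.
Proof.
have /asboolP[p hp ->] := piece_valP x; apply/asboolP.
by exists (pull f p); [exact: pull_multihomog | rewrite coinv_mapE].
Qed.

Definition piece_map (x : coinv_piece A J T) : coinv_piece A J S :=
  CoinvPiece (coinv_map_piece x).

Lemma piece_map_is_linear : linear piece_map.
Proof. by move=> a x y; apply: val_inj; exact: linearP. Qed.

HB.instance Definition _ := GRing.isLinear.Build A (coinv_piece A J T)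
  (coinv_piece A J S) *:%R piece_map piece_map_is_linear.

End OneMap.

Lemma piece_map_id (T : finType) (x : coinv_piece A J T) :
  piece_map (FIid T) x = x.
Proof.
apply: val_inj => /=; have [p ->] := coinv_pi_surj x.
by rewrite coinv_mapE pull_id.
Qed.

Lemma piece_map_comp (S T U : finType) (g : FIhom T U) (f : FIhom S T)
  (x : coinv_piece A J U) :
  piece_map (FIcomp g f) x = piece_map f (piece_map g x).
Proof.
apply: val_inj => /=; have [p ->] := coinv_pi_surj x.
by rewrite !coinv_mapE pull_comp.
Qed.

Lemma dual_piece_id (T : finType) (phi : dual (coinv_piece A J T)) :
  dual_map (piece_map (FIid T)) phi = phi.
Proof. by apply: dualP => x /=; rewrite piece_map_id. Qed.

Lemma dual_piece_comp (S T U : finType) (g : FIhom T U) (f : FIhom S T)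
  (phi : dual (coinv_piece A J S)) :
  dual_map (piece_map (FIcomp g f)) phi
    = dual_map (piece_map g) (dual_map (piece_map f) phi).
Proof. by apply: dualP => x /=; rewrite piece_map_comp. Qed.

Definition coinv_dual : FImodule A :=
  @FIModule A (fun T => dual (coinv_piece A J T))
    (fun S T f => dual_map (piece_map f)) dual_piece_id dual_piece_comp.

End PieceMap.

(* Main.v *)
Require Import Defs.
From mathcomp Require Import all_boot all_order all_algebra.
From mathcomp Require Import boolp classical_sets mpoly zify.

Set Implicit Arguments.
Unset Strict Implicit.
Unset Printing Implicit Defensive.

Import Order.TTheory GRing.Theory.

Local Open Scope ring_scope.

(** A functional phi on R_J(T) is determined by its values on the monomials
    x_h = prod_k x_(col k, h k), where h : D -> T and D is a set of |J| slots
    with colouring col. This embeds the dual of R_J in the FI-module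
    T |-> A^(D -> T), compatibly with the FI-structures, so it suffices to show
    that an FI-module with such coordinates is finitely generated; this is a
    Groebner basis argument. Order the maps D -> [n] lexicographically;
    strictly increasing maps [n] -> [n'] preserve this order, hence leading
    terms. By Dickson's lemma, applied to the gaps between the values of h,
    every infinite sequence of maps h contains an infinite chain for the
    relation h' = f o h with f strictly increasing, and along such a chain the
    ideals of leading coefficients increase, hence stabilize since A is
    noetherian. So finitely many h control all leading coefficients, and
    subtracting leading terms shows that finitely many elements generate. *)

(** * Dickson's lemma and finiteness principles *)

(** Each next index minimizes [x] over the tail past the current one; minima over shrinking tails do
    not decrease. *)
Lemma nat_nondecreasing_subseq (x : nat -> nat) :
  exists2 g : nat -> nat, {homo g : i j / (i < j)%N} &
    forall i j, (i <= j)%N -> (x (g i) <= x (g j))%N.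
Proof.
have /choice[mu muP] N :
    exists m, (N <= m)%N /\ forall k, (N <= k)%N -> (x m <= x k)%N.
  have exN : exists v, `[< exists2 m, (N <= m)%N & x m = v >].
    by exists (x N); apply/asboolP; exists N.
  case: (ex_minnP exN) => v /asboolP[m Nm <-] xmin; exists m; split=> // k Nk.
  by apply: xmin; apply/asboolP; exists k.
pose g := fix g i := if i is j.+1 then mu (g j).+1 else mu 0.
have g_lt : {homo g : i j / (i < j)%N}.
  by apply: homo_ltn => [i j k|i /=]; [exact: ltn_trans|case: (muP (g i).+1)].
exists g => // i j; rewrite leq_eqVlt => /predU1P[-> //|ij].
case: i ij => [|i] ij; first by case: (muP 0) => _; apply.
case: (muP (g i).+1) => _; apply; apply: ltn_trans (g_lt _ _ ij).
exact: g_lt.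
Qed.

(** Coordinates are treated one at a time: further thinning keeps the earlier ones nondecreasing. *)
Lemma dickson (K : finType) (x : nat -> K -> nat) :
  exists2 g : nat -> nat, {homo g : i j / (i < j)%N} &
    forall i j k, (i <= j)%N -> (x (g i) k <= x (g j) k)%N.
Proof.
suff [g g_lt gP] : exists2 g : nat -> nat, {homo g : i j / (i < j)%N} &
    forall i j k, k \in enum K -> (i <= j)%N -> (x (g i) k <= x (g j) k)%N.
  by exists g => // i j k; apply: gP; rewrite mem_enum.
elim: (enum K) => [|k s [g g_lt gP]]; first by exists id.
have [g' g'_lt g'P] := nat_nondecreasing_subseq (fun i => x (g i) k).
exists (g \o g') => [i j /g'_lt/g_lt //|i j l].
rewrite inE => /predU1P[->|ls] ij; first exact: g'P.
apply: gP => //; apply: (homo_leq (@leqnn) leq_trans) ij => m.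
exact: ltnW (g'_lt _ _ (ltnSn m)).
Qed.

(** The union of the chain is an ideal, and some [I N] contains its finitely many generators. *)
Lemma noetherian_chain (A : comNzRingType) (I : nat -> set A) :
  noetherian A -> (forall i, is_ideal (I i)) ->
  (forall i j, (i <= j)%N -> (I i `<=` I j)%classic) ->
  exists N, forall i, (I i `<=` I N)%classic.
Proof.
move=> hA idI leI; pose U : set A := fun a => exists i, I i a.
have idU : is_ideal U.
  split=> [|a x y [i Ix] [j Iy]]; first by exists 0; case: (idI 0).
  exists (maxn i j); apply: (idI (maxn i j)).2.
    exact: leI (leq_maxl i j) _ Ix.
  exact: leI (leq_maxr i j) _ Iy.
have [s Us] := hA U idU.
have sU a : a \in s -> U a.
  move=> a_s; rewrite Us; exists [:: (1, a)]; split=> [u|].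
    by rewrite inE => /eqP ->.
  by rewrite big_seq1 mul1r.
have [N NP] : exists N, forall a, a \in s -> I N a.
  elim: s {Us} sU => [|a s IHs] sU; first by exists 0.
  have [a' a's|N NP] := IHs; first by apply: sU; rewrite inE a's orbT.
  have [i Ia] := sU a (mem_head a s); exists (maxn i N) => b.
  rewrite inE => /predU1P[->|/NP]; [exact: leI (leq_maxl i N) _ Ia|].
  exact: leI (leq_maxr i N) _.
exists N => i a Ia; have : U a by exists i.
rewrite Us => -[t [ts ->]]; rewrite big_seq.
apply: (big_ind (I N)); first by case: (idI N).
  by move=> b c Ib Ic; rewrite -[b]mul1r; apply: (idI N).2.
by move=> u /ts/NP Iu; rewrite -[_ * _]addr0; have [I0 IL] := idI N; exact: IL.
Qed.

(** Otherwise, repeatedly choosing an element that is [Q]-above no earlier choice gives a sequence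
    without a good pair. *)
Lemma finite_basis (X : eqType) (Q : X -> X -> Prop) :
  (forall x : nat -> X, exists i j, (i < j)%N /\ Q (x i) (x j)) ->
  exists F : seq X, forall y, exists2 x, x \in F & Q x y.
Proof.
move=> goodQ; apply: contrapT => noF.
have /choice[next nextP] (F : seq X) : exists y, forall x, x \in F -> ~ Q x y.
  apply: contrapT => noy; apply: noF; exists F => y.
  apply: contrapT => nox; apply: noy; exists y => x xF Qxy.
  by apply: nox; exists x.
pose L := fix L i := if i is j.+1 then next (L j) :: L j else [::].
have [i [j [ij]]] := goodQ (next \o L); apply: nextP.
elim: j ij => //= j IHj; rewrite ltnS leq_eqVlt inE => /predU1P[->|/IHj ->].
  by rewrite eqxx.
by rewrite orbT.
Qed.

(** * Increasing maps with prescribed values *)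

(* The successor makes the truncated subtractions in the last hypothesis say
   two things: if P b <= P a then P' b <= P' a, and P a - P b <= P' a - P' b. *)
Lemma stretch (K : finType) (P P' : K -> nat) (a0 : K) :
  P a0 = 0%N -> P' a0 = 0%N ->
  (forall a b, (P a).+1 - P b <= (P' a).+1 - P' b)%N ->
  exists2 f : nat -> nat, {homo f : x y / (x < y)%N} & forall a, f (P a) = P' a.
Proof.
(* The shift at [x] is the largest one required at a value [P b <= x]; it is nondecreasing in [x],
   so [x + g x] is strictly increasing. *)
move=> P0 P'0 gap; pose g x := (\max_(b | P b <= x) (P' b - P b))%N.
exists (fun x => x + g x)%N => [x y xy|a].
  rewrite -addSn leq_add //; apply/bigmax_leqP => b bx.
  by apply: leq_bigmax_cond; apply: leq_trans bx (ltnW xy).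
suff -> : g (P a) = (P' a - P a)%N.
  by have := gap a a0; rewrite P0 P'0; lia.
apply/eqP; rewrite eqn_leq leq_bigmax_cond // andbT.
by apply/bigmax_leqP => b ba; have := gap a b; have := gap b a0; lia.
Qed.

(* The values of x, shifted by one, together with the sentinels 0 and n.+1: gaps
   between these also measure the room left at both ends of 'I_n. *)
Definition padded_value (D : finType) (x : {n : nat & {ffun D -> 'I_n}})
    (a : option (option D)) : nat :=
  match a with
  | None => 0
  | Some None => (tag x).+1
  | Some (Some k) => (tagged x k).+1
  end.

Lemma stretch_ord (D : finType) (x y : {n : nat & {ffun D -> 'I_n}}) :
  (forall a b, (padded_value x a).+1 - padded_value x b
     <= (padded_value y a).+1 - padded_value y b)%N ->
  exists2 f : FIhom 'I_(tag x) 'I_(tag y),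
    {homo f : i j / (i < j)%N} & tagged y = [ffun k => f (tagged x k)].
Proof.
case: x y => [n h] [n' h'] gap.
have [f f_lt fP] := @stretch _ _ _ None erefl erefl gap.
(* Sentinels go to sentinels, so [f] maps 1..n into 1..n'. *)
have f0 := fP None; have fn := fP (Some None); rewrite /= in f0 fn.
have f_gt0 (i : nat) : (0 < f i.+1)%N by rewrite -[X in (X < _)%N]f0 f_lt.
have f_bound (i : 'I_n) : ((f i.+1).-1 < n')%N.
  by have := f_lt i.+1 n.+1 (ltn_ord i); have := f_gt0 i; rewrite fn; lia.
pose fo (i : 'I_n) := Ordinal (f_bound i).
have fo_lt : {homo fo : i j / (i < j)%N}.
  by move=> i j ij /=; have := f_lt i.+1 j.+1 ij; have := f_gt0 i; lia.
have fo_inj : injective fo.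
  move=> i j /(congr1 (fun k : 'I_n' => k : nat)) fij; apply: ord_inj.
  case: (ltngtP i j) => // /fo_lt; lia.
exists (FIHom fo_inj) => //; apply/ffunP => k; apply: val_inj.
by rewrite ffunE /= (fP (Some (Some k))).
Qed.

(** * Lexicographic order and Groebner bases in coordinates *)

Definition lex_key (D : finType) n (h : {ffun D -> 'I_n}) :
  seqlexi 'I_n := [seq h k | k <- enum D].

Lemma lex_key_inj (D : finType) n : injective (@lex_key D n).
Proof.
move=> h h' /eq_in_map hh'; apply/ffunP => k.
by apply: hh'; rewrite mem_enum.
Qed.

Lemma lex_key_homo (D : finType) n n' (f : 'I_n -> 'I_n')
    (h h' : {ffun D -> 'I_n}) : {homo f : i j / (i < j)%N} ->
  (lex_key [ffun k => f (h k)] <= lex_key [ffun k => f (h' k)])%O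
    = (lex_key h <= lex_key h')%O.
Proof.
move=> f_lt; have f_mono : {mono f : i j / (i <= j)%O}.
  by apply: le_mono => i j; exact: f_lt.
rewrite /lex_key; elim: (enum D) => // k s IHs.
by rewrite /= !lexi_cons IHs !ffunE !f_mono.
Qed.

Section Coordinates.
Variables (A : comNzRingType) (V : FImodule A) (D : finType).
Variable c : forall T : finType, V T -> {ffun D -> T} -> A.
Hypothesis hA : noetherian A.
Hypothesis c_linear : forall T a (v w : V T) h,
  c (a *: v + w) h = a * c v h + c w h.
Hypothesis c_inj : forall T (v : V T), (forall h, c v h = 0) -> v = 0.
(** Together with the next hypothesis: on coordinates, [f] acts by extension by zero along
    composition with [f]. *)
Hypothesis c_map : forall S T (f : FIhom S T) (v : V S) (h : {ffun D -> _}),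
  c (FImap V f v) [ffun k => f (h k)] = c v h.
Hypothesis c_map_out : forall S T (f : FIhom S T) (v : V S) (h : {ffun D -> _}),
  (forall h' : {ffun D -> S}, h <> [ffun k => f (h' k)]) -> c (FImap V f v) h = 0.

Let c0 T h : c (0 : V T) h = 0.
Proof.
have := c_linear 1 (0 : V T) 0 h; rewrite scaler0 addr0 mul1r => /eqP.
by rewrite -subr_eq0 opprD addrA subrr add0r oppr_eq0 => /eqP.
Qed.

(** [c v h] itself may vanish, so that these [v] form a submodule. *)
Definition lead_bound n (h : {ffun D -> 'I_n}) (v : V 'I_n) :=
  forall h', (lex_key h < lex_key h')%O -> c v h' = 0.

Lemma lead_boundP n (h : {ffun D -> 'I_n}) a v w :
  lead_bound h v -> lead_bound h w -> lead_bound h (a *: v + w).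
Proof.
by move=> hv hw h' hh'; rewrite c_linear hv // hw // mulr0 addr0.
Qed.

Definition lead_ideal (x : {n : nat & {ffun D -> 'I_n}}) : set A :=
  fun a => exists2 v, lead_bound (tagged x) v & c v (tagged x) = a.

Lemma lead_ideal_is_ideal x : is_ideal (lead_ideal x).
Proof.
split; first by exists 0 => // h' _; rewrite c0.
move=> a _ _ [v hv <-] [w hw <-]; exists (a *: v + w); last by rewrite c_linear.
exact: lead_boundP.
Qed.

(** A map above [f o h] either is [f o h''] with [h''] above [h], or does not factor through [f] and
    has coordinate zero. *)
Lemma lead_bound_map n n' (f : FIhom 'I_n 'I_n') h v :
  {homo f : i j / (i < j)%N} -> lead_bound h v ->
  lead_bound [ffun k => f (h k)] (FImap V f v).
Proof.
move=> f_lt hv h' hh'.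
have [[h'' h'E] | nh'] :=
    pselect (exists h'' : {ffun D -> _}, h' = [ffun k => f (h'' k)]).
  by rewrite h'E c_map hv // ltNge -(lex_key_homo _ _ f_lt) -ltNge -h'E.
by apply: c_map_out => h'' eh'; apply: nh'; exists h''.
Qed.

(** Analogue of divisibility of leading terms: any leading term at [y] can be cancelled by the
    [f]-image of an element bounded by [x]. *)
Definition divides_lead (x y : {n : nat & {ffun D -> 'I_n}}) : Prop :=
  (exists2 f : FIhom 'I_(tag x) 'I_(tag y),
    {homo f : i j / (i < j)%N} & tagged y = [ffun k => f (tagged x k)])
  /\ (lead_ideal y `<=` lead_ideal x)%classic.

(** Dickson's lemma on gaps gives a subsequence satisfying the first clause; its lead ideals
    increase, and the pair is taken where they are stable. *)
Lemma divides_lead_good (x : nat -> {n : nat & {ffun D -> 'I_n}}) :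
  exists i j, (i < j)%N /\ divides_lead (x i) (x j).
Proof.
pose gap i (ab : option (option D) * option (option D)) :=
  ((padded_value (x i) ab.1).+1 - padded_value (x i) ab.2)%N.
have [g g_lt gP] := dickson gap.
have oi i j : (i <= j)%N ->
    exists2 f : FIhom 'I_(tag (x (g i))) 'I_(tag (x (g j))),
    {homo f : k l / (k < l)%N} &
    tagged (x (g j)) = [ffun k => f (tagged (x (g i)) k)].
  by move=> ij; apply: stretch_ord => a b; exact: (gP i j (a, b) ij).
have [|i j ij a|N NP] := @noetherian_chain A (lead_ideal \o (x \o g)) hA.
- by move=> i; exact: lead_ideal_is_ideal.
- have [f f_lt xf] := oi i j ij; move=> [v vP <-].
  by exists (FImap V f v); rewrite xf ?c_map //; exact: lead_bound_map.
exists (g N), (g N.+1); split; first exact: g_lt.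
by split; [exact: oi (leqnSn N) | exact: NP].
Qed.

(** One witness per generator of each lead ideal suffices: combinations of witnesses stay in [W] and
    realize the whole ideal. *)
Lemma lead_generators (F : seq {n : nat & {ffun D -> 'I_n}}) :
  exists s : seq {n : nat & V 'I_n}, forall W : subFImodule V,
    (forall y, y \in s -> W 'I_(tag y) (tagged y)) ->
    forall x a, x \in F -> lead_ideal x a ->
      exists v, [/\ W _ v, lead_bound (tagged x) v & c v (tagged x) = a].
Proof.
elim: F => [|x F [s sP]]; first by exists [::].
have [G Ix] := hA (lead_ideal_is_ideal x).
have GI a : a \in G -> lead_ideal x a.
  move=> aG; rewrite Ix; exists [:: (1, a)]; split=> [u|].
    by rewrite inE => /eqP ->.
  by rewrite big_seq1 mul1r.
have [t tP] : exists t : seq {n : nat & V 'I_n}, forall a, a \in G ->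
    exists v, [/\ Tagged (fun n => V 'I_n) v \in t,
      lead_bound (tagged x) v & c v (tagged x) = a].
  elim: G {Ix} GI => [|a G IHG] GI; first by exists [::].
  have [b bG|t tP] := IHG; first by apply: GI; rewrite inE bG orbT.
  have [v vx va] := GI a (mem_head a G).
  exists (Tagged (fun n => V 'I_n) v :: t) => b.
  rewrite inE => /predU1P[->|/tP[w [wt wx wb]]].
    by exists v; split=> //; exact: mem_head.
  by exists w; split=> //; rewrite inE wt orbT.
exists (t ++ s) => W Wts y a; rewrite inE => /predU1P[->|yF]; last first.
  by apply: sP => // z zs; apply: Wts; rewrite mem_cat zs orbT.
rewrite Ix => -[u [uG ->]]; rewrite big_seq.
apply: (big_ind (fun a => exists v, [/\ W _ v, lead_bound (tagged x) v
  & c v (tagged x) = a])).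
- by exists 0; split; [exact: subFI0 | move=> h' _ |]; rewrite c0.
- move=> _ _ [v [Wv vx <-]] [w [Ww wx <-]]; exists (1 *: v + w); split.
  + exact: subFIlin.
  + exact: lead_boundP.
  + by rewrite c_linear mul1r.
move=> z /uG /tP[v [vt vx <-]]; exists (z.1 *: v + 0); split.
- apply: subFIlin; last exact: subFI0.
  by apply: (Wts (Tagged (fun n => V 'I_n) v)); rewrite mem_cat vt.
- by apply: lead_boundP => // h' _; rewrite c0.
- by rewrite c_linear c0 addr0.
Qed.

Lemma FImap_isoK (S T : finType) (f : FIhom S T) (g : FIhom T S) (v : V S) :
  cancel f g -> FImap V g (FImap V f v) = v.
Proof.
move=> fK; rewrite -FImap_comp; suff -> : FIcomp g f = FIid S by rewrite FImap_id.
rewrite /FIcomp /FIid; move: (inj_comp _ _) (@inj_id S).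
have -> : g \o f = id by apply/funext => z; exact: fK.
by move=> i1 i2; congr FIHom; exact: Prop_irrelevance.
Qed.

(** Division algorithm: the leading term of [v] is cancelled by the image of an element of [W],
    leaving a smaller remainder. *)
Theorem coordinates_finitely_generated : FI_finitely_generated V.
Proof.
have [F FP] := finite_basis divides_lead_good.
have [s sP] := lead_generators F.
exists s => W Ws [S]; apply; apply/seteqP; split=> // v _.
pose f := FIHom (@enum_rank_inj S); pose g := FIHom (@enum_val_inj S predT).
rewrite -(FImap_isoK (f := f) (g := g) v (@enum_rankK S)).
apply: subFImap; move: (FImap V f v); move: #|S| => n {f g v} v.
(* The down-set generated by the support of [v]; its cardinality is the induction measure. *)
pose low (v : V 'I_n) : {set {ffun D -> 'I_n}} :=
  [set h | [exists h', (c v h' != 0) && (lex_key h <= lex_key h')%O]].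
have [m] := ubnP #|low v|; elim: m v => // m IHm v /ltnSE low_m.
have [[h0 h0P]|v0] := pselect (exists h, c v h != 0); last first.
  rewrite (@c_inj _ v) => [|h]; first exact: subFI0.
  by apply: contrapT => ch; apply: v0; exists h; apply/eqP.
case: (@arg_maxP _ _ _ h0 (fun h => c v h != 0)
  (fun h => lex_key h) h0P) => h hP h_max.
have v_h : lead_bound h v.
  move=> h' hh'; apply: contrapT => /eqP/h_max/(lt_le_trans hh').
  by rewrite ltxx.
have [x xF [[f f_lt /= hE] Ixh]] := FP (Tagged (fun n => {ffun D -> 'I_n}) h).
have [|w [Ww w_x cw]] := sP W Ws x (c v h) xF; first by apply: Ixh; exists v.
have cfw : c (FImap V f w) h = c v h by rewrite hE c_map cw -hE.
have fw_h : lead_bound h (FImap V f w) by rewrite hE; exact: lead_bound_map.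
pose u := - 1 *: FImap V f w + v.
have -> : v = 1 *: FImap V f w + u.
  by rewrite scale1r /u scaleN1r addrA subrr add0r.
apply: subFIlin; first exact: subFImap.
have cu h' : (lex_key h <= lex_key h')%O -> c u h' = 0.
  rewrite le_eqVlt => /predU1P[/lex_key_inj <-|hh'].
    by rewrite c_linear cfw mulN1r addNr.
  by rewrite c_linear fw_h // v_h // mulr0 addr0.
(* The support of [u] lies strictly below [h], so [low u] is inside [low v] and misses [h]. *)
apply: IHm; apply: leq_trans low_m; apply: proper_card; apply/properP; split.
  apply/fintype.subsetP => h'; rewrite !inE => /existsP[h'' /andP[ch'' h'h'']].
  apply/existsP; exists h; rewrite hP /=.
  apply: le_trans h'h'' _.
  by apply: ltW; rewrite ltNge; apply: contra ch'' => /cu ->.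
exists h; rewrite inE.
  by apply/existsP; exists h; rewrite hP /=.
by apply/existsP => -[h' /andP[ch' /cu/eqP]]; apply/negP.
Qed.

End Coordinates.

(** * Monomial coordinates on the dual of the graded piece *)

Section SlotCoordinates.
Variables (A : comNzRingType) (r : nat) (J : 'I_r -> nat).

Local Notation slot := {i : 'I_r & 'I_(J i)}.

(** [J i] slots have colour [i]. Permuting slots of one colour gives the same monomial: the
    parametrization is redundant, but spanning is enough. *)
Definition slot_monomial (T : finType) (h : {ffun slot -> T}) : FIpoly A r T :=
  \prod_(k : slot) FIvar A (tag k) (h k).

Lemma slot_monomial_multihomog (T : finType) (h : {ffun slot -> T}) :
  multihomog J (slot_monomial h).
Proof.
pose E (k : slot) i := (tag k == i) : nat.
have hE k : multihomog (E k) (FIvar A (tag k) (h k)) by exact: multihomog_FIvar.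
move=> m /(multihomog_prod (s := index_enum _) hE) mE i; rewrite mE.
rewrite -(sig_big_dep xpredT (fun _ => xpredT) (fun i' _ => (i' == i) : nat)).
rewrite (bigD1 i) //= eqxx sum1_card card_ord big1 ?addn0 // => i' /negPf ->.
exact: big1_eq.
Qed.

Lemma pull_slot_monomial (S T : finType) (f : FIhom S T)
    (h : {ffun slot -> S}) :
  pull f (slot_monomial [ffun k => f (h k)]) = slot_monomial h.
Proof.
rewrite /slot_monomial rmorph_prod; apply: eq_bigr => k _.
by rewrite ffunE; exact: pull_FIvar_im.
Qed.

(** Some [h k] misses the image of [f], and its variable pulls back to zero. *)
Lemma pull_slot_monomial_notin (S T : finType) (f : FIhom S T)
    (h : {ffun slot -> T}) :
  (forall h' : {ffun slot -> S}, h <> [ffun k => f (h' k)]) ->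
  pull f (slot_monomial h) = 0.
Proof.
move=> nh; have [k hk] : exists k, forall s, f s <> h k.
  apply: contrapT => nk; have [h' h'P] : exists h', forall k, f (h' k) = h k.
    apply: (fin_all_exists (P := fun k s => f s = h k)) => k.
    apply: contrapT => ns; apply: nk; exists k => s fs.
    by apply: ns; exists s.
  by apply: (nh (finfun h')); apply/ffunP => k; rewrite !ffunE h'P.
by rewrite /slot_monomial rmorph_prod (bigD1 k) //= pull_FIvar_notin // mul0r.
Qed.

Lemma mpolyX_slot_monomial (T : finType) (m : 'X_{1.. #|{: 'I_r * T}|}) :
  (forall i, (\sum_(t : T) m (enum_rank (i, t)))%N = J i) ->
  exists h, 'X_[m] = slot_monomial h.
Proof.
move=> mJ.
have [s sP] : exists s : forall i, (J i).-tuple T, forall i,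
    \prod_(t : T) FIvar A i t ^+ m (enum_rank (i, t))
      = \prod_(j < J i) FIvar A i (tnth (s i) j).
  apply: (fin_all_exists (P := fun i (s : (J i).-tuple T) =>
    \prod_(t : T) FIvar A i t ^+ m (enum_rank (i, t))
      = \prod_(j < J i) FIvar A i (tnth s j))) => i.
  (* Each [t] is repeated according to its exponent, so the list exactly fills the slots of colour
     [i]. *)
  pose l := flatten [seq nseq (m (enum_rank (i, t))) t | t <- enum T].
  have l_size : size l == J i.
    rewrite size_flatten /shape -map_comp sumnE big_map big_enum /= -mJ.
    by apply/eqP; apply: eq_bigr => t _; rewrite size_nseq.
  exists (Tuple l_size); rewrite -(big_tuple _ _ (Tuple l_size) xpredT) /=.
  rewrite big_flatten big_map big_enum /=; apply: eq_bigr => t _.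
  by rewrite big_nseq; elim: (m _) => //= e <-; rewrite exprS.
exists [ffun k => tnth (s (tag k)) (tagged k)].
rewrite /slot_monomial; under [RHS]eq_bigr do rewrite ffunE.
rewrite -(sig_big_dep xpredT (fun _ => xpredT)
  (fun i j => FIvar A i (tnth (s i) j))) /=.
under [RHS]eq_bigr do rewrite -sP.
rewrite pair_bigA /= mpolyXE_id (reindex (@enum_rank ('I_r * T)%type)) /=.
  by apply: eq_bigr => -[i t].
by apply: onW_bij; exact: enum_rank_bij.
Qed.

Lemma slot_piece_subproof (T : finType) (h : {ffun slot -> T}) :
  coinv_pi (slot_monomial h) \in @in_coinv_piece A r J T.
Proof.
by apply/asboolP; exists (slot_monomial h) => //; exact: slot_monomial_multihomog.
Qed.

Definition slot_piece (T : finType) (h : {ffun slot -> T}) : coinv_piece A J T :=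
  CoinvPiece (slot_piece_subproof h).

(** Injectivity of the coordinates: classes of slot monomials span the piece. *)
Lemma slot_piece_span (T : finType) (phi : dual (coinv_piece A J T)) :
  (forall h, phi (slot_piece h) = 0) -> phi = 0.
Proof.
move=> phi0; apply: dualP => x; change (phi x = 0).
have /asboolP[p p_hom xp] := piece_valP x.
have /choice[y yP] (m : 'X_{1.. #|{: 'I_r * T}|}) :
    exists y : coinv_piece A J T, phi y = 0 /\
      (m \in msupp p -> piece_val y = coinv_pi 'X_[m]).
  have [mp|] := boolP (m \in msupp p); last by exists 0; rewrite linear0.
  have [h hm] := mpolyX_slot_monomial (p_hom m mp).
  by exists (slot_piece h); rewrite hm.
have -> : x = \sum_(m <- msupp p) p@_m *: y m.
  apply: val_inj; rewrite [LHS]xp [in LHS](mpolyE p) linear_sum linear_sum.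
  rewrite !big_seq; apply: eq_bigr => m mp.
  by rewrite linearZ [RHS]linearZ /= (yP m).2.
rewrite linear_sum big1 // => m _.
by rewrite linearZ /= (yP m).1 scaler0.
Qed.

Definition slot_coord (T : finType) (phi : dual (coinv_piece A J T)) h : A :=
  phi (slot_piece h).

End SlotCoordinates.

Theorem theoremF (A : comNzRingType) (hA : noetherian A) (r : nat)
  (hr : (1 <= r)%N) (J : 'I_r -> nat) :
  FI_finitely_generated (coinv_dual A J).
Proof.
apply: (@coordinates_finitely_generated A (coinv_dual A J)
  {i : 'I_r & 'I_(J i)} (@slot_coord A r J) hA) => //.
- by move=> T v; exact: slot_piece_span.
(* On the dual, [f] acts through pullback, which sends the monomial of [f o h] to that of [h] and
   all other slot monomials to 0. *)
- move=> S T f v h; congr (v _); apply: val_inj => /=.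
  by rewrite coinv_mapE pull_slot_monomial.
move=> S T f v h nh; rewrite -[RHS](linear0 v); congr (v _).
by apply: val_inj => /=; rewrite coinv_mapE pull_slot_monomial_notin // linear0.
Qed.
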